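(* Let $n\ge 1$ and let $S=\operatorname{conv}(P_1,\ldots,P_{n+1})\subset\mathbb{R}^n$ be a nondegenerate $n$-simplex of volume $V$. Let $M$ be an interior point of $S$, and let $V_1(M),\ldots,V_{n+1}(M)$ be the volumes of the $n+1$ facet-parallel corner simplexes of $S$ determined by $M$. Let $E_J(S)$ be the John ellipsoid of $S$ and $\partial E_J(S)$ its boundary. Then \[ M\in\partial E_J(S)\quad\Longleftrightarrow\quad \sum_{i=1}^{n+1}V_i(M)^{2/n}=\frac1n\,V^{2/n}. \]
   Context: Facet-parallel corner simplexes: let $\lambda_1,\ldots,\lambda_{n+1}>0$ be the barycentric coordinates of the interior point $M$ with respect to $P_1,\ldots,P_{n+1}$ (so $\sum_i\lambda_i=1$ and $M=\sum_i\lambda_iP_i$). The hyperplanes through $M$ parallel to the facets of $S$ determine $n+1$ small simplexes homothetic to $S$. The $i$-th one is $M+\lambda_i(S-P_i)$, i.e. the set of points of $S$ whose $j$-th barycentric coordinate is at least $\lambda_j$ for every $j\ne i$; it is the simplex with vertex $M$ bounded by the facet of $S$ opposite $P_i$ and by the hyperplanes through $M$ parallel to the other $n$ facets. It is a copy of $S$ with linear ratio $\lambda_i$. $V_i(M)$ denotes its $n$-dimensional volume. John ellipsoid: $E_J(S)$ is the unique (solid) ellipsoid of maximal volume contained in $S$. *)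

(* Defs.v *)
From mathcomp Require Import all_boot all_order all_algebra.
From mathcomp Require Import all_classical all_reals all_analysis.

Set Implicit Arguments.
Unset Strict Implicit.
Unset Printing Implicit Defensive.

Import Order.TTheory GRing.Theory Num.Theory.
Import numFieldNormedType.Exports.

Local Open Scope classical_set_scope.
Local Open Scope ring_scope.

Section EuclideanVolume.
Variables (R : realType) (n : nat).

Definition box (a b : 'rV[R]_n) : set 'rV[R]_n :=
  [set x : 'rV[R]_n | forall j, a 0 j <= x 0 j <= b 0 j].

(* n-dimensional Lebesgue outer measure: the infimum of the total volumes of
   the countable covers of A by closed boxes.  It coincides with Lebesgue
   measure on measurable sets, in particular on compact ones. *)
Definition vol (A : set 'rV[R]_n) : \bar R :=
  ereal_inf [set v : \bar R | exists a b : nat -> 'rV[R]_n,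
    [/\ forall k j, a k 0 j <= b k 0 j,
        A `<=` \bigcup_k box (a k) (b k) &
        v = (\sum_(0 <= k <oo) (\prod_j (b k 0 j - a k 0 j))%:E)%E]].

End EuclideanVolume.

Section Simplex.
Variables (R : realType) (n : nat).

Definition barycentric (P : 'I_n.+1 -> 'rV[R]_n) (x : 'rV[R]_n)
    (lam : 'I_n.+1 -> R) : Prop :=
  \sum_i lam i = 1 /\ x = \sum_i lam i *: P i.

Definition simplex (P : 'I_n.+1 -> 'rV[R]_n) : set 'rV[R]_n :=
  [set x | exists2 lam : 'I_n.+1 -> R, (forall i, 0 <= lam i) & barycentric P x lam].

Definition affinely_independent (P : 'I_n.+1 -> 'rV[R]_n) : bool :=
  row_free (\matrix_(i < n) (P (lift ord0 i) - P ord0)).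

(* M + lam i (S - P i), where lam is meant to be the family of barycentric
   coordinates of M. *)
Definition corner_simplex (P : 'I_n.+1 -> 'rV[R]_n) (M : 'rV[R]_n)
    (lam : 'I_n.+1 -> R) (i : 'I_n.+1) : set 'rV[R]_n :=
  [set M + lam i *: (x - P i) | x in simplex P].

End Simplex.

Section JohnEllipsoid.
Variables (R : realType) (n : nat).

(* The norm of the library on 'rV[R]_n is the sup norm, hence the explicit
   sum of squares. *)
Definition euclidean_ball : set 'rV[R]_n :=
  [set u : 'rV[R]_n | \sum_j u 0 j ^+ 2 <= 1].

Definition is_ellipsoid (E : set 'rV[R]_n) : Prop :=
  exists c : 'rV[R]_n, exists2 B : 'M[R]_n, B \in unitmx &
    E = [set c + u *m B | u in euclidean_ball].

Definition max_volume_ellipsoid (K E : set 'rV[R]_n) : Prop :=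
  [/\ is_ellipsoid E, E `<=` K &
      forall E', is_ellipsoid E' -> E' `<=` K -> (vol E' <= vol E)%E].

(* The default value set0 is only used when no maximal ellipsoid exists; for a
   nondegenerate simplex there is exactly one. *)
Definition john_ellipsoid (K : set 'rV[R]_n) : set 'rV[R]_n :=
  xget set0 [set E | max_volume_ellipsoid K E].

Definition boundary (A : set 'rV[R]_n) : set 'rV[R]_n :=
  closure A `\` interior A.

End JohnEllipsoid.

(* Main.v *)
(* In barycentric coordinates the John ellipsoid of S is the set where the sum of
   the squares of the coordinates is at most 1/n, and the i-th corner simplex has
   volume lambda_i^n V, so both sides of the equivalence say that the sum of the
   lambda_i^2 is 1/n.  An ellipsoid c + uB, |u| <= 1, has barycentric coordinates
   mu + uW, where mu are those of c, and it lies in S iff each column of W has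
   norm at most mu_i.  Hadamard's inequality for the matrix with rows mu / sqrt n
   and W, followed by AM-GM for the mu_i, bounds |det B|; equality forces
   mu_i = 1/(n+1) and W W^T = I / (n(n+1)), which determines the ellipsoid.
   That the outer measure scales by |det B| only needs the inequality "<=" (the
   other one follows by applying it to the inverse), which LU decomposition
   reduces to diagonal, permutation and unipotent matrices. *)
Require Import Defs.
From mathcomp Require Import all_boot all_order all_algebra.
From mathcomp Require Import all_classical all_reals all_analysis.
From mathcomp Require Import perm zify ring lra.
Import Order.TTheory GRing.Theory Num.Theory.
Import numFieldNormedType.Exports.
Local Open Scope classical_set_scope.
Local Open Scope ring_scope.

Set Implicit Arguments.
Unset Strict Implicit.
Unset Printing Implicit Defensive.

(** * Lebesgue outer measure and linear maps *)

Lemma vol_ge0 (R : realType) (n : nat) (A : set 'rV[R]_n) : (0 <= vol A)%E.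
Proof.
apply: le_ereal_inf_tmp => _ [a [b [ab _ ->]]].
apply: nneseries_ge0 => k _ _; rewrite lee_fin.
by apply: prodr_ge0 => j _; rewrite subr_ge0.
Qed.

Lemma le_vol (R : realType) (n : nat) (A B : set 'rV[R]_n) :
  A `<=` B -> (vol A <= vol B)%E.
Proof.
move=> AB; apply: ereal_inf_le_tmp => v [a [b [ab Bab ->]]].
by exists a, b; split => //; exact: subset_trans Bab.
Qed.

Lemma vol_cover (R : realType) (n : nat) (A : set 'rV[R]_n) (r e : R) :
  0 < e -> (vol A <= r%:E)%E ->
  exists a b : nat -> 'rV[R]_n, [/\ forall k j, a k 0 j <= b k 0 j,
    A `<=` \bigcup_k box (a k) (b k) &
    (\sum_(0 <= k <oo) (\prod_j (b k 0 j - a k 0 j))%:E <= (r + e)%:E)%E].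
Proof.
move=> e0 Ar; have Afin : vol A \is a fin_num.
  by rewrite ge0_fin_numE ?vol_ge0// (le_lt_trans Ar) ?ltry.
have [_ [a [b [ab Aab ->]]] lt_e] := lb_ereal_inf_adherent e0 Afin.
exists a, b; split => //; apply: (le_trans (ltW lt_e)).
by rewrite EFinD leeD2r.
Qed.

(** Allowing an excess [e / 2 ^ k.+1] in the cover of each [F k] and enumerating the double family
    by a bijection between [nat] and [nat * nat] yields one cover of [A]. *)
Lemma vol_sigma_subadditive (R : realType) (n : nat) (A : set 'rV[R]_n)
    (F : nat -> set 'rV[R]_n) (v : nat -> R) :
  A `<=` \bigcup_k F k -> (forall k, vol (F k) <= (v k)%:E)%E ->
  (vol A <= \sum_(0 <= k <oo) (v k)%:E)%E.
Proof.
move=> AF Fv.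
have v0 k : (0 <= (v k)%:E)%E := le_trans (vol_ge0 _) (Fv k).
apply/lee_addgt0Pr => e e0.
apply: le_trans (@epsilon_trick R (fun k => (v k)%:E) e xpredT v0 (ltW e0)).
have ek k : 0 < e / (2 ^ k.+1)%:R by rewrite divr_gt0// ltr0n expn_gt0.
have /choice[G PG] : forall k, exists ab : (nat -> 'rV[R]_n) * (nat -> 'rV[R]_n),
    [/\ forall i j, ab.1 i 0 j <= ab.2 i 0 j,
      F k `<=` \bigcup_i box (ab.1 i) (ab.2 i) &
      (\sum_(0 <= i <oo) (\prod_j (ab.2 i 0 j - ab.1 i 0 j))%:E <=
        (v k + e / (2 ^ k.+1)%:R)%:E)%E].
  by move=> k; have [a [b P]] := vol_cover (ek k) (Fv k); exists (a, b).
pose w (i : nat * nat) : \bar R :=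
  (\prod_j ((G i.1).2 i.2 0 j - (G i.1).1 i.2 0 j))%:E.
have w0 i : (0 <= w i)%E.
  by rewrite lee_fin; apply: prodr_ge0 => j _; rewrite subr_ge0; have [] := PG i.1.
apply: (@le_trans _ _ (\esum_(i in setT) w i)%E).
  have /card_esym/ppcard_eqP[f] := card_nat2.
  apply: ereal_inf_lbound.
  exists (fun k => (G (f k).1).1 (f k).2), (fun k => (G (f k).1).2 (f k).2); split.
  - by move=> k j; have [] := PG (f k).1.
  - move=> x /AF[k _ Fkx]; have [_ /(_ _ Fkx)[i _ Gx] _] := PG k.
    by exists (f^-1%FUN (k, i)) => //=; rewrite invK ?inE.
  - rewrite nneseries_esumT => [|k]; last exact: (w0 (f k)).
    apply: (@reindex_esum R _ _ setT setT f w).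
    by rewrite setTT_bijective; exact: bijTT.
rewrite (_ : [set: nat * nat] = setT `*`` (fun=> setT)); last first.
  by apply/seteqP; split => // -[].
rewrite (_ : w = fun i => w (i.1, i.2)); last by apply/funext => -[].
rewrite -(@esum_esum R nat nat setT (fun=> setT) (fun i j => w (i, j)))//.
rewrite nneseries_esumT => [|k]; last first.
  by rewrite adde_ge0// lee_fin ltW.
apply: le_esum => k _.
by rewrite -nneseries_esumT => [|i]//; have [] := PG k.
Qed.

(** The box followed by copies of the degenerate [box a a] is a cover. The dimension is positive, as
    an empty product would give these copies volume 1. *)
Lemma vol_box_le (R : realType) (n : nat) (a b : 'rV[R]_n.+1) :
  (forall j, a 0 j <= b 0 j) ->
  (vol (box a b) <= (\prod_j (b 0 j - a 0 j))%:E)%E.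
Proof.
move=> ab; apply: ereal_inf_lbound.
exists (fun k => a), (fun k => if k is 0%N then b else a); split.
- by move=> [|k] j.
- by move=> x xab; exists 0%N.
- rewrite (nneseries_split 0 1) => [|[|k] _]; last 2 first.
  + by rewrite lee_fin; apply: prodr_ge0 => j _; rewrite subr_ge0.
  + by rewrite lee_fin; apply: prodr_ge0 => j _; rewrite subr_ge0.
  rewrite add0n big_nat1 eseries0 ?adde0// => -[//|k] _ _.
  by rewrite big_ord_recl subrr mul0r.
Qed.

Lemma vol_finite_cover (R : realType) (n : nat) (I : finType)
    (A : set 'rV[R]_n.+1) (F : I -> set 'rV[R]_n.+1) (v : R) :
  A `<=` \bigcup_i F i -> (forall i, vol (F i) <= v%:E)%E ->
  (vol A <= (#|I|%:R * v)%:E)%E.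
Proof.
move=> AF Fv.
have vol0 : (vol (set0 : set 'rV[R]_n.+1) <= 0%:E)%E.
  have /le_trans := @le_vol R _ set0 (box (0 : 'rV[R]_n.+1) 0) (@sub0set _ _).
  apply; have := @vol_box_le R n 0 0 (fun=> lexx _).
  by rewrite big_ord_recl subrr mul0r.
pose G k := if insub k is Some i then F (enum_val (i : 'I_#|I|)) else set0.
pose w k : R := if (k < #|I|)%N then v else 0.
have AG : A `<=` \bigcup_k G k.
  move=> x /AF[i _ Fx]; exists (enum_rank i) => //.
  by rewrite /G valK /= enum_rankK.
have Gw k : (vol (G k) <= (w k)%:E)%E.
  by rewrite /G /w; case: insubP => [i -> _|/negbTE ->]; [exact: Fv|exact: vol0].
apply: (le_trans (vol_sigma_subadditive AG Gw)).
have w0 k : (0 <= (w k)%:E)%E := le_trans (vol_ge0 _) (Gw k).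
rewrite (nneseries_split 0 #|I|) => [|k _]; last exact: w0.
rewrite add0n eseries0 ?adde0; last by move=> k lek _; rewrite /w ltnNge lek.
rewrite sumEFin lee_fin big_mkord (eq_bigr (fun=> v)) => [|i _]; last first.
  by rewrite /w ltn_ord.
by rewrite sumr_const card_ord mulr_natl.
Qed.

(** * Affine images and the determinant *)

(** Bounds linearly in [d] the cost of widening a box. The constant 2 leaves one copy of [r] to
    absorb [q] and one to absorb [d * r] in the induction, which therefore carries [0 <= q <= r]. *)
Lemma prod_addr_le (R : realType) (n : nat) (h : 'I_n -> R) (d : R) :
  (forall j, 0 <= h j) -> 0 <= d <= 1 ->
  \prod_j (h j + d) <= \prod_j h j + d * \prod_j (h j + 2).
Proof.
move=> h0 /andP[d0 d1].
suff [] : [/\ \prod_j (h j + d) <= \prod_j h j + d * \prod_j (h j + 2),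
    0 <= \prod_j h j & \prod_j h j <= \prod_j (h j + 2)] by [].
apply: (big_rec3 (fun p q r => [/\ p <= q + d * r, 0 <= q & q <= r])).
  by split => //; rewrite mulr1 lerDl.
move=> j p q r _ [pq q0 qr]; have := h0 j; move: (h j) => x x0; split.
- apply: (@le_trans _ _ ((x + d) * (q + d * r))); first by rewrite ler_wpM2l// addr_ge0.
  rewrite -subr_ge0.
  have -> : x * q + d * ((x + 2) * r) - (x + d) * (q + d * r)
    = d * ((r - q) + (1 - d) * r) by ring.
  by rewrite mulr_ge0// addr_ge0 ?subr_ge0// mulr_ge0 ?subr_ge0// (le_trans q0).
- exact: mulr_ge0.
- by rewrite ler_pM// lerDl.
Qed.

Definition affine_image (R : realType) (n : nat) (c : 'rV[R]_n) (B : 'M[R]_n)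
    (A : set 'rV[R]_n) : set 'rV[R]_n :=
  [set c + x *m B | x in A].

(** The real bound [v] avoids products with [+oo], and quantifying over [c] makes translations
    harmless under composition. *)
Definition dilates (R : realType) (n : nat) (B : 'M[R]_n) (C : R) : Prop :=
  forall c A v, (vol A <= v%:E)%E -> (vol (affine_image c B A) <= (C * v)%:E)%E.

(* The box is covered by cubes of side [1/N], at most [N h + 1] of them along an
   edge of length [h]; the excess vanishes as [N] grows. *)
Lemma vol_affine_box (R : realType) (n : nat) (B : 'M[R]_n.+1) (a b : 'rV[R]_n.+1)
    (c p q : 'rV[R]_n.+1) :
  (forall x, box 0 (const_mx 1) x -> box a b (x *m B)) ->
  (forall j, p 0 j <= q 0 j) ->
  (vol (affine_image c B (box p q)) <=
    ((\prod_j (b 0 j - a 0 j)) * \prod_j (q 0 j - p 0 j))%:E)%E.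
Proof.
move=> Bab pq.
set C := \prod_j (b 0 j - a 0 j); set h := fun j => q 0 j - p 0 j.
have h0 j : 0 <= h j by rewrite subr_ge0.
have ab j : a 0 j <= b 0 j.
  have /Bab/(_ j) : box 0 (const_mx 1) (0 : 'rV[R]_n.+1).
    by move=> k; rewrite !mxE lexx ler01.
  by move=> /andP[]; exact: le_trans.
have C0 : 0 <= C by apply: prodr_ge0 => j _; rewrite subr_ge0.
have uE (u z : 'rV[R]_n.+1) s j : (u + s *: z) 0 j = u 0 j + s * z 0 j.
  by rewrite !mxE.
have grid N : (vol (affine_image c B (box p q)) <=
    (C * \prod_j (h j + N.+1%:R^-1))%:E)%E.
  set N' : R := N.+1%:R; have N'0 : 0 < N' by rewrite ltr0n.
  (* The successor accounts for the last cube, which may stick out of the box. *)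
  pose m j := (Num.truncn (N' * h j)).+1.
  pose I := {dffun forall j, 'I_(m j)}.
  pose pt (f : I) : 'rV[R]_n.+1 := \row_j (p 0 j + (f j)%:R / N').
  pose Q f := box (c + pt f *m B + N'^-1 *: a) (c + pt f *m B + N'^-1 *: b).
  have cover : affine_image c B (box p q) `<=` \bigcup_f Q f.
    move=> _ [x xpq <-].
    have fP (j : 'I_n.+1) : (Num.truncn (N' * (x 0 j - p 0 j))%R < m j)%N.
      rewrite ltnS le_truncn// ler_wpM2l ?(ltW N'0)// lerB//.
      by have /andP[] := xpq j.
    exists [ffun j => Ordinal (fP j)] => // j.
    set f : I := [ffun j => _].
    (* Relative to its grid point and rescaled by [N'], [x] lies in the unit cube, where [Bab]
       applies. *)
    have /Bab/(_ j) : box 0 (const_mx 1) (N' *: (x - pt f)).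
      move=> k; rewrite !mxE ffunE /=.
      have /truncn_itv : 0 <= N' * (x 0 k - p 0 k).
        by rewrite mulr_ge0 ?(ltW N'0)// subr_ge0; have /andP[] := xpq k.
      set t := Num.truncn _ => /andP[lo hi].
      have -> : N' * (x 0 k - (p 0 k + t%:R / N')) = N' * (x 0 k - p 0 k) - t%:R.
        by field; rewrite gt_eqF.
      by rewrite subr_ge0 lo lerBlDl -natr1 in hi *; rewrite ltW.
    have -> : c + x *m B = c + pt f *m B + N'^-1 *: ((N' *: (x - pt f)) *m B).
      rewrite -scalemxAl scalerA mulVf ?gt_eqF// scale1r mulmxBl.
      by rewrite -addrA; congr (_ + _); rewrite [RHS]addrC subrK.
    move: (_ *m B) => y /andP[ay yb].
    rewrite /Q -/f; move: (c + pt f *m B) => u; rewrite /= !uE.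
    by rewrite !lerD2l !ler_pM2l ?invr_gt0// ay.
  have volQ f : (vol (Q f) <= (\prod_j (N'^-1 * (b 0 j - a 0 j)))%:E)%E.
    apply: le_trans (vol_box_le _) _ => [j|].
      by rewrite !uE lerD2l ler_pM2l ?invr_gt0.
    rewrite lee_fin le_eqVlt; apply/orP; left; apply/eqP.
    by apply: eq_bigr => j _; rewrite !uE; ring.
  apply: le_trans (vol_finite_cover cover volQ) _.
  rewrite lee_fin card_dep_ffun foldrE big_map big_enum /= natr_prod.
  rewrite big_split /= -/C mulrA mulrC ler_wpM2l// -big_split /=.
  apply: ler_prod => j _; rewrite card_ord mulr_ge0 ?invr_ge0 ?(ltW N'0)//=.
  rewrite ler_pdivrMr// mulrDl mulVf ?gt_eqF// -natr1 lerD2r mulrC.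
  by rewrite truncn_le mulr_ge0// ltW.
apply/lee_addgt0Pr => e e0.
set K := \prod_j (h j + 2).
have [N NK] : exists N, C * K / e < N%:R :> R.
  exists (Num.bound (C * K / e)); apply: archi_boundP.
  by rewrite divr_ge0 ?(ltW e0)// mulr_ge0// prodr_ge0// => j _; rewrite addr_ge0.
apply: (le_trans (grid N)); rewrite -EFinD lee_fin.
have N0 : (0 : R) < N.+1%:R by rewrite ltr0n.
apply: (@le_trans _ _ (C * (\prod_j h j + N.+1%:R^-1 * K))).
  rewrite ler_wpM2l// prod_addr_le// invr_ge0 ltW//= invf_le1// ler1n//.
rewrite mulrDr lerD2l mulrCA ler_pdivrMl// -ler_pdivrMr//.
by rewrite (le_trans (ltW NK))// ler_nat.
Qed.

Lemma vol_le_EFin_ge0 (R : realType) (n : nat) (A : set 'rV[R]_n) (v : R) :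
  (vol A <= v%:E)%E -> 0 <= v.
Proof. by move=> Av; rewrite -lee_fin (le_trans _ Av)// vol_ge0. Qed.

(** [vol_affine_box] bounds the images of boxes; countable subadditivity transfers the bound to any
    set through its covers. *)
Lemma dilates_cube (R : realType) (n : nat) (B : 'M[R]_n.+1) (a b : 'rV[R]_n.+1) :
  (forall x, box 0 (const_mx 1) x -> box a b (x *m B)) ->
  dilates B (\prod_j (b 0 j - a 0 j)).
Proof.
move=> Bab c A v Av; set C := \prod_j _.
have C0 : 0 <= C.
  apply: prodr_ge0 => j _.
  have /Bab/(_ j) : box 0 (const_mx 1) (0 : 'rV[R]_n.+1).
    by move=> k; rewrite !mxE lexx ler01.
  by rewrite subr_ge0 => /andP[]; exact: le_trans.
apply/lee_addgt0Pr => e e0.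
have e'0 : 0 < e / (C + 1) by rewrite divr_gt0// ltr_wpDl.
have [p [q [pq Apq pqv]]] := vol_cover e'0 Av.
have sub : affine_image c B A `<=` \bigcup_k affine_image c B (box (p k) (q k)).
  by move=> _ [x /Apq[k _ xk] <-]; exists k => //; exists x.
apply: (le_trans (vol_sigma_subadditive sub (fun k => vol_affine_box c Bab (pq k)))).
rewrite (eq_eseriesr (fun k _ => EFinM _ _)) nneseriesZl => [|k _]; last first.
  by rewrite lee_fin prodr_ge0// => j _; rewrite subr_ge0.
apply: (@le_trans _ _ (C%:E * (v + e / (C + 1))%:E)%E); first by rewrite lee_wpmul2l.
rewrite -EFinM -EFinD lee_fin mulrDr lerD2l mulrCA ler_piMr ?(ltW e0)//.
by rewrite ler_pdivrMr ?mul1r ?lerDl// ltr_wpDl.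
Qed.

Lemma dilates_lim (R : realType) (n : nat) (B : 'M[R]_n) (C : R) :
  (forall e, 0 < e -> exists2 C', dilates B C' & C' <= C + e) -> dilates B C.
Proof.
move=> BC c A v Av; have v0 := vol_le_EFin_ge0 Av.
apply/lee_addgt0Pr => e e0.
have e'0 : 0 < e / (v + 1) by rewrite divr_gt0// ltr_wpDl.
have [C' BC' C'C] := BC _ e'0; apply: (le_trans (BC' c A v Av)).
rewrite -EFinD lee_fin (le_trans (ler_wpM2r v0 C'C))// mulrDl lerD2l.
by rewrite mulrAC -mulrA ler_piMr ?(ltW e0)// ler_pdivrMr ?mul1r ?lerDl// ltr_wpDl.
Qed.

Lemma affine_imageM (R : realType) (n : nat) (c c' : 'rV[R]_n) (B B' : 'M[R]_n)
    (A : set 'rV[R]_n) :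
  affine_image c' B' (affine_image c B A) = affine_image (c' + c *m B') (B *m B') A.
Proof.
apply/seteqP; split => [_ [_ [x Ax <-] <-]|_ [x Ax <-]].
  by exists x => //; rewrite mulmxDl addrA mulmxA.
exists (c + x *m B); first by exists x.
by rewrite mulmxDl addrA mulmxA.
Qed.

Lemma dilates_mul (R : realType) (n : nat) (B B' : 'M[R]_n) (C C' : R) :
  dilates B C -> dilates B' C' -> dilates (B *m B') (C * C').
Proof.
move=> BC BC' c A v Av.
have := BC' c _ _ (BC 0 A v Av).
by rewrite affine_imageM mul0mx addr0 mulrA [C' * C]mulrC.
Qed.

(** The unit cube goes to a box with edges between 0 and [d 0 j], in the order given by the sign.
    Zero entries are allowed, which serves for corner simplexes of ratio 0. *)
Lemma dilates_diag (R : realType) (n : nat) (d : 'rV[R]_n.+1) :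
  dilates (diag_mx d) (\prod_j `|d 0 j|).
Proof.
have := @dilates_cube R n (diag_mx d) (\row_j Num.min 0 (d 0 j)) (\row_j Num.max 0 (d 0 j)).
rewrite (eq_bigr (fun j => `|d 0 j|)) => [|j _]; last first.
  rewrite !mxE; case: (leP 0 (d 0 j)) => [d0|d0]; first by rewrite subr0 ger0_norm.
  by rewrite sub0r ltr0_norm.
apply=> x x01 j; rewrite mul_mx_diag !mxE.
have /andP[] := x01 j; rewrite !mxE => x0 x1.
case: (leP 0 (d 0 j)) => [d0|d0]; first by rewrite mulr_ge0//= ler_piMl.
by rewrite mulr_ge0_le0 ?(ltW d0)// andbT ler_niMl// ltW.
Qed.

Lemma dilates_perm (R : realType) (n : nat) (s : 'S_n.+1) :
  dilates (perm_mx s : 'M[R]_n.+1) 1.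
Proof.
have := @dilates_cube R n (perm_mx s) 0 (const_mx 1).
rewrite big1 => [|j _]; last by rewrite !mxE subr0.
apply=> x x01 j; rewrite -[s]invgK -col_permE !mxE.
by have := x01 (s^-1%g j); rewrite !mxE.
Qed.

(** Each coordinate of a point of the unit cube moves by at most [n.+1 * d], so the image lies in
    the cube widened by that margin on both sides. *)
Lemma dilates_near1 (R : realType) (n : nat) (B : 'M[R]_n.+1) (d : R) :
  (forall i j, `|B i j - (i == j)%:R| <= d) ->
  dilates B ((1 + 2 * n.+1%:R * d) ^+ n.+1).
Proof.
move=> Bd; set e := n.+1%:R * d.
have := @dilates_cube R n B (const_mx (- e)) (const_mx (1 + e)).
rewrite (eq_bigr (fun=> 1 + 2 * n.+1%:R * d)) => [|j _]; last by rewrite !mxE /e; ring.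
rewrite prodr_const card_ord; apply=> x x01 j; rewrite !mxE.
have xj k : 0 <= x 0 k <= 1 by have := x01 k; rewrite !mxE.
suff : `|\sum_k x 0 k * B k j - x 0 j| <= e.
  by have /andP[] := xj j; rewrite ler_norml => ? ? /andP[? ?]; apply/andP; split; lra.
have -> : x 0 j = \sum_k x 0 k * (k == j)%:R.
  rewrite (bigD1 j)//= eqxx mulr1 big1 ?addr0// => k /negbTE ->.
  by rewrite mulr0.
rewrite -sumrB (le_trans (ler_norm_sum _ _ _))// /e.
rewrite -[n.+1 in leRHS]card_ord mulr_natl -sumr_const ler_sum// => k _.
rewrite -mulrBr normrM; have /andP[x0 x1] := xj k.
by rewrite (ger0_norm x0) (le_trans _ (Bd k j))// ler_piMl.
Qed.

(* Conjugating by [diag (t^w)] makes [B] tend to the identity as [t] tends to 0. *)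
Lemma dilates_unipotent (R : realType) (n : nat) (B : 'M[R]_n.+1) (w : 'I_n.+1 -> nat) :
  (forall i, B i i = 1) ->
  (forall i j, i != j -> B i j != 0 -> (w j < w i)%N) ->
  dilates B 1.
Proof.
move=> B1 Bw; apply: dilates_lim => e e0.
pose K := \sum_i \sum_j `|B i j|.
have BK i j : `|B i j| <= K.
  rewrite /K (bigD1 i)//= (bigD1 j)//= -addrA lerDl addr_ge0 ?sumr_ge0// => k _.
  by rewrite sumr_ge0.
have K0 : 0 <= K := le_trans (normr_ge0 _) (BK ord0 ord0).
pose h : {poly R} := (1 + (2 * n.+1%:R * K) *: 'X) ^+ n.+1.
have hE t : h.[t] = (1 + 2 * n.+1%:R * (K * t)) ^+ n.+1.
  by rewrite /h !hornerE; congr (_ ^+ _); ring.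
(* Continuity of [h] at 0, where its value is 1, supplies [t]. *)
have [t /andP[t0 t1] ht] : exists2 t, 0 < t <= 1 & h.[t] <= 1 + e.
  have /(_ 0) := @continuous_horner R h; move=> /cvgrPdist_le /(_ _ e0).
  move=> /nbhs_ballP[r /= r0 hr].
  have t0 : 0 < Num.min (r / 2) 1 by rewrite lt_min divr_gt0//=.
  exists (Num.min (r / 2) 1); first by rewrite t0 ge_min lexx orbT.
  have /hr : ball (0 : R) r (Num.min (r / 2) 1).
    rewrite /ball /= sub0r normrN gtr0_norm//.
    by rewrite gt_min ltr_pdivrMr// ltr_pMr// ltr1n.
  have -> : h.[0] = 1 by rewrite hE !mulr0 addr0 expr1n.
  by rewrite ler_norml => /andP[+ _]; lra.
exists h.[t]; rewrite {}hE // in ht *.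
pose D (s : R) : 'rV[R]_n.+1 := \row_j s ^+ w j.
have tn0 : t != 0 by rewrite gt_eqF.
have DV : diag_mx (D t^-1) *m diag_mx (D t) = 1%:M.
  apply/matrixP => i j; rewrite mul_diag_mx !mxE.
  case: eqVneq => [->|]; last by rewrite !mulr0n mulr0.
  by rewrite !mulr1n -exprMn mulVf// expr1n.
pose T := diag_mx (D t) *m B *m diag_mx (D t^-1).
have TE i j : T i j = t ^+ w i * B i j * t^-1 ^+ w j.
  by rewrite /T mul_mx_diag mul_diag_mx !mxE.
have BT : B = diag_mx (D t^-1) *m T *m diag_mx (D t).
  by rewrite /T !mulmxA DV mul1mx -mulmxA DV mulmx1.
have near1 i j : `|T i j - (i == j)%:R| <= K * t.
  rewrite TE; case: (eqVneq i j) => [<-|ij].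
    by rewrite B1 mulr1 -exprMn divff// expr1n subrr normr0 mulr_ge0// ltW.
  rewrite subr0; have [->|Bij] := eqVneq (B i j) 0.
    by rewrite mulr0 mul0r normr0 mulr_ge0// ltW.
  (* The entry is [B i j * t ^+ (w i - w j)] with a positive exponent, hence at most [K * t] in
     absolute value as [t <= 1]. *)
  have wij := Bw _ _ ij Bij.
  rewrite mulrAC exprVn -expfB// normrM mulrC ler_pM//.
  rewrite ger0_norm ?exprn_ge0 ?(ltW t0)//.
  by rewrite -[leRHS]expr1 ler_wiXn2l ?(ltW t0)// subn_gt0.
have := dilates_mul (dilates_mul (dilates_diag (D t^-1)) (dilates_near1 near1)) (dilates_diag (D t)).
rewrite -BT mulrAC -big_split /= big1 ?mul1r// => j _.
by rewrite !mxE -normrM -exprMn mulVf// expr1n normr1.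
Qed.

(** In the decomposition [P B = L U], [L] is unit lower triangular and [U] is a unit upper
    triangular matrix times its diagonal. Only that diagonal contributes, and its product is
    [\det B] up to sign. *)
Lemma dilates_det (R : realType) (n : nat) (B : 'M[R]_n.+1) :
  B \in unitmx -> dilates B `|\det B|.
Proof.
move=> Bu.
have := cormen_lup_correct B; have := cormen_lup_perm B.
have := cormen_lup_detL B; have := cormen_lup_lower B; have := cormen_lup_upper B.
case: (cormen_lup B) => [[P L] U] /= Uu Ll detL /is_perm_mxP[s Ps] PB.
rewrite -!mulmxE {}Ps in PB.
have detU : \det U = \prod_j U j j.
  rewrite -det_tr det_trig; first by apply: eq_bigr => j _; rewrite mxE.
  by apply/is_trig_mxP => i j ij; rewrite mxE Uu.
have normU : `|\det U| = `|\det B|.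
  have /(congr1 (fun x => `|x|)) := congr1 determinant PB.
  by rewrite !det_mulmx detL mul1r det_perm normrM normr_sign mul1r => ->.
have Ujj j : U j j != 0.
  have : \det U != 0 by rewrite -normr_eq0 normU normr_eq0 -unitfE -unitmxE.
  by rewrite detU prodf_seq_neq0 => /allP/(_ j (mem_index_enum j)).
have -> : `|\det B| = 1 * 1 * 1 * \prod_j `|(\row_j U j j) 0 j|.
  rewrite !mul1r -normU detU normr_prod.
  by apply: eq_bigr => j _; rewrite mxE.
have -> : B = perm_mx s^-1%g *m L *m (U *m diag_mx (\row_j (U j j)^-1))
    *m diag_mx (\row_j U j j).
  rewrite -mulmxA.
  have -> : U *m diag_mx (\row_j (U j j)^-1) *m diag_mx (\row_j U j j) = U.
    by apply/matrixP => i j; rewrite !mul_mx_diag !mxE mulfVK.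
  by rewrite -mulmxA -PB mulmxA -perm_mxM mulVg perm_mx1 mul1mx.
apply: dilates_mul (dilates_diag _).
apply: dilates_mul (dilates_mul (dilates_perm _) _) _.
- apply: (@dilates_unipotent _ _ _ (fun i => val i)) => [i|i j ij].
    by rewrite Ll// eqxx.
  by apply: contraNT; rewrite -leqNgt => le; rewrite Ll// (negbTE ij).
(* The weights are reversed because the nonzero off-diagonal entries now lie above the diagonal. *)
- apply: (@dilates_unipotent _ _ _ (fun i => n - val i)%N) => [i|i j ij].
    by rewrite mul_mx_diag !mxE divff.
  apply: contraNT; rewrite -leqNgt leq_subLR => le.
  have ji : (j < i)%N.
    rewrite ltn_neqAle eq_sym ij /=.
    by have := leq_ord i; have := leq_ord j; move: le => /=; lia.
  by rewrite mul_mx_diag mxE Uu ?mul0r.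
Qed.

Lemma vol_affine_image (R : realType) (n : nat) (c : 'rV[R]_n.+1) (B : 'M[R]_n.+1)
    (A : set 'rV[R]_n.+1) (v : R) :
  B \in unitmx -> vol A = v%:E -> vol (affine_image c B A) = (`|\det B| * v)%:E.
Proof.
move=> Bu Av.
have le1 : (vol (affine_image c B A) <= (`|\det B| * v)%:E)%E.
  by apply: (dilates_det Bu); rewrite Av.
have : vol (affine_image c B A) \is a fin_num.
  by rewrite ge0_fin_numE ?vol_ge0// (le_lt_trans le1) ?ltry.
move: le1; case E : (vol _) => [w| |]// le1 _.
apply/eqP; rewrite eq_le le1 lee_fin /=.
have Bu' : invmx B \in unitmx by rewrite unitmx_inv.
have Aw : (vol (affine_image c B A) <= w%:E)%E by rewrite E.
(* With this translation, [invmx B] inverts the affine map and gives the reverse inequality. *)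
have := dilates_det Bu' (- (c *m invmx B)) Aw.
rewrite affine_imageM mulmxV// addNr.
have -> : affine_image 0 1%:M A = A.
  apply/seteqP; split => [_ [x Ax <-]|x Ax]; first by rewrite add0r mulmx1.
  by exists x => //; rewrite add0r mulmx1.
rewrite Av lee_fin det_inv normfV ler_pdivlMl//.
by rewrite normr_gt0 -unitfE -unitmxE.
Qed.

(** * Positivity of the outer measure *)

(** Subtracting the least element [p] embeds the set into ['I_K.+1], with [K] the integer part of
    [y - x]. *)
Lemma card_ord_itv (R : realType) (N : nat) (x y : R) : x <= y ->
  #|[pred p : 'I_N | x <= p%:R <= y]|%:R <= y - x + 1.
Proof.
move=> xy; set S := [pred p : 'I_N | _].
have [p0 Sp0|S0] := pickP (mem S); last first.
  have -> : #|S| = 0%N := eq_card0 S0.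
  by rewrite addr_ge0 ?subr_ge0.
have [p Sp pmin] := @arg_minnP _ p0 (mem S) val Sp0.
pose K := Num.truncn (y - x).
have SK q : q \in S -> (p <= q)%N /\ (q - p <= K)%N.
  move=> Sq; have pq : (p <= q)%N by exact: pmin.
  split=> //; move: Sq Sp; rewrite !inE => /andP[_ qy] /andP[xp _].
  rewrite /K truncn_ge_nat ?subr_ge0// natrB//.
  by rewrite lerB.
have inj : {in S &, injective (fun q : 'I_N => inord (q - p) : 'I_K.+1)}.
  move=> q r /SK[pq qK] /SK[pr rK] /(congr1 val); rewrite /= !inordK// => qr.
  by apply/val_inj => /=; rewrite -(subnK pq) qr subnK.
apply: (@le_trans _ _ K.+1%:R).
  by rewrite ler_nat -(card_in_image inj) (leq_trans (max_card _))// card_ord.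
by rewrite -natr1 lerD2r truncn_le subr_ge0.
Qed.

(* Finitely many slightly enlarged boxes of a cover suffice by compactness, and
   they contain all points of the cube with coordinates [p/N]; counting these
   points and letting [N] grow compares the volumes. *)
Lemma vol_unit_cube_ge1 (R : realType) (n : nat) :
  (1%:E <= vol (box 0%R (const_mx 1%R) : set 'rV[R]_n.+1))%E.
Proof.
apply: le_ereal_inf_tmp => _ [a [b [ab cover ->]]].
apply/lee_addgt0Pr => e e0.
pose h k j := b k 0 j - a k 0 j.
have h0 k j : 0 <= h k j by rewrite subr_ge0.
have V0 k : (0 <= (\prod_j h k j)%:E)%E by rewrite lee_fin prodr_ge0.
apply: le_trans (@epsilon_trick R (fun k => (\prod_j h k j)%:E) e xpredT V0 (ltW e0)).
pose ek k : R := e / (2 ^ k.+1)%:R.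
have ek0 k : 0 < ek k by rewrite divr_gt0// ltr0n expn_gt0.
pose Q k := \prod_j (h k j + 2).
have Q0 k : 0 < Q k by rewrite prodr_gt0// => j _; rewrite ltr_wpDl.
(* Chosen so that [eta k <= 1] and [eta k * Q k <= ek k]: widening every edge of the [k]-th box by
   [eta k] costs at most [ek k]. *)
pose eta k := ek k / (Q k + ek k).
have Qek0 k : 0 < Q k + ek k by rewrite addr_gt0.
have eta0 k : 0 < eta k by rewrite divr_gt0.
have eta1 k : eta k <= 1 by rewrite ler_pdivrMr// mul1r lerDr ltW.
have etaQ k : \prod_j (h k j + eta k) <= \prod_j h k j + ek k.
  apply: (le_trans (prod_addr_le (h0 k) _)); first by rewrite eta1 ltW.
  rewrite lerD2l /eta mulrAC -/(Q k) ler_pdivrMr// ler_wpM2l ?(ltW (ek0 k))//.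
  by rewrite lerDl ltW.
(* Two thirds of [eta k] widen the box on its two sides; the last third pays for the extra 1 in the
   point count. *)
pose d k := eta k / 3.
have d0 k : 0 < d k by rewrite divr_gt0.
pose W k := box (a k - const_mx (d k)) (b k + const_mx (d k)).
have cubeC : compact (box 0 (const_mx 1) : set 'rV[R]_n.+1).
  have := @rV_compact R n.+1 (fun=> `[0, 1]%classic) (fun=> @segment_compact _ _ _).
  congr compact; apply/seteqP; split => x x01 j; have := x01 j.
    by rewrite /= in_itv /= !mxE.
  by rewrite /= in_itv /= !mxE.
rewrite compact_cover in cubeC.
have [||D _ cubeD] := @cubeC nat setT (fun k => interior (W k)).
- by move=> k _; exact: open_interior.
- move=> x /cover[k _ xk]; exists k => //; apply/nbhs_ballP; exists (d k) => //= y xy j.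
  have := xy.2 0 j; have /andP[] := xk j; rewrite /ball /= ltr_distlC !mxE.
  by move=> ? ? /andP[? ?]; apply/andP; split; lra.
pose m := (\max_(k <- finmap.enum_fset D) k).+1.
have cubem x : box 0 (const_mx 1) x -> exists2 k, (k < m)%N & W k x.
  move=> /cubeD[k kD Wk]; exists k; last exact: interior_subset Wk.
  by rewrite ltnS; apply: leq_bigmax_seq.
(* Makes the mesh [1 / N] at most [d k] for every [k < m]. *)
pose N := (\sum_(k < m) Num.bound (d k)^-1).+1.
have Nd k : (k < m)%N -> N%:R^-1 <= d k.
  move=> km; rewrite -[leRHS]invrK lef_pV2 ?posrE ?invr_gt0//.
  have /ltW/le_trans : (d k)^-1 < (Num.bound (d k)^-1)%:R.
    by apply: archi_boundP; rewrite invr_ge0 ltW.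
  apply; rewrite ler_nat /N (bigD1 (Ordinal km))//=.
  by rewrite -addnS leq_addr.
have N0 : (0 : R) < N%:R by rewrite ltr0n.
pose S k j := [pred p : 'I_N | N%:R * (a k 0 j - d k) <= p%:R <= N%:R * (b k 0 j + d k)].
have SN k j : #|S k j|%:R <= N%:R * (h k j + 2 * d k) + 1.
  apply: (le_trans (card_ord_itv _ _)).
    by rewrite ler_pM2l//; have := ab k j; have := d0 k; lra.
  by rewrite lerD2r /h -mulrBr ler_pM2l//; lra.
(* Each of the [N ^ n.+1] grid points lies in some [W k], and [W k] contains [\prod_j #|S k j|] of
   them. *)
have count : (N ^ n.+1 <= \sum_(k < m) \prod_j #|S k j|)%N.
  pose pt (f : {ffun 'I_n.+1 -> 'I_N}) : 'rV[R]_n.+1 := \row_j (N%:R^-1 * (f j)%:R).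
  have ptS f : exists k : 'I_m, f \in family (fun j => S k j).
    have [|k km Wk] := cubem (pt f).
      move=> j; rewrite !mxE mulr_ge0 ?invr_ge0 ?(ltW N0)//= ler_pdivrMl// mulr1.
      by rewrite ler_nat ltnW.
    exists (Ordinal km); apply/familyP => j; have := Wk j.
    by rewrite !mxE !inE ler_pdivlMl// ler_pdivrMl.
  have -> : (N ^ n.+1)%N = #|{ffun 'I_n.+1 -> 'I_N}| by rewrite card_ffun !card_ord.
  rewrite -sum1_card (eq_bigr (fun k : 'I_m => \sum_(f | f \in family (fun j => S k j)) 1)%N).
    rewrite (exchange_big_dep xpredT)//=; apply: leq_sum => f _.
    by have [k fk] := ptS f; rewrite (bigD1 k).
  by move=> k _; rewrite sum1_card card_family foldrE big_map big_enum.
apply: (@le_trans _ _ (\sum_(0 <= k < m) (\prod_j h k j + ek k)%:E)%E); last first.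
  apply: (nneseries_lim_ge m) => k _ _.
  by rewrite lee_fin addr_ge0 ?(ltW (ek0 k))// prodr_ge0.
rewrite sumEFin lee_fin big_mkord.
apply: (@le_trans _ _ (\sum_(k < m) \prod_j (N%:R^-1 * #|S k j|%:R))).
  rewrite (eq_bigr (fun k : 'I_m => N%:R^-1 ^+ n.+1 * (\prod_j #|S k j|)%:R)) => [|k _]; last first.
    by rewrite big_split /= prodr_const card_ord natr_prod.
  by rewrite -mulr_sumr -natr_sum exprVn ler_pdivlMl ?exprn_gt0// mulr1 -natrX ler_nat.
apply: ler_sum => k _; apply: le_trans (etaQ k); apply: ler_prod => j _.
rewrite mulr_ge0 ?invr_ge0 ?(ltW N0)//= ler_pdivrMl//.
apply: (le_trans (SN _ _)).
have Nd1 : 1 <= N%:R * d k by rewrite -ler_pdivrMl// mulr1 Nd.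
have -> : eta k = 3 * d k by rewrite /d; field.
have -> : N%:R * (h k j + 3 * d k) = N%:R * (h k j + 2 * d k) + N%:R * d k by ring.
by rewrite lerD2l.
Qed.


(** A sup-norm ball of radius [r] around [x] contains a translate of the unit cube scaled by
    [r / 2], and the unit cube has outer measure 1. *)
Lemma vol_interior_gt0 (R : realType) (n : nat) (A : set 'rV[R]_n.+1) (x : 'rV[R]_n.+1) :
  interior A x -> (0%:E < vol A)%E.
Proof.
move=> /nbhs_ballP[r /= r0 rA].
set Q : set 'rV[R]_n.+1 := box 0 (const_mx 1).
have Q1 : (vol Q <= 1%:E)%E.
  have := @vol_box_le R n 0 (const_mx 1); rewrite big1 => [|j _]; last by rewrite !mxE subr0.
  by apply=> j; rewrite !mxE.
have QE : vol Q = 1%:E by apply/eqP; rewrite eq_le Q1 vol_unit_cube_ge1.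
have r2 : 0 < r / 2 by rewrite divr_gt0.
have rB : (r / 2)%:M \in @unitmx R n.+1.
  by rewrite unitmxE det_scalar unitfE expf_neq0// gt_eqF.
apply: (@lt_le_trans _ _ (vol (affine_image x (r / 2)%:M Q))).
  rewrite (vol_affine_image x rB QE) lte_fin mulr1 normr_gt0.
  by rewrite -unitfE -unitmxE.
apply: le_vol => _ [y Qy <-]; apply: rA; split=> // i j.
rewrite ord1 /ball /= mul_mx_scalar !mxE opprD addNKr normrN.
have := Qy j; rewrite !mxE => /andP[y0 y1].
rewrite ger0_norm; last by rewrite mulr_ge0 // ltW.
by rewrite (@le_lt_trans _ _ (r / 2)) ?ler_piMr ?(ltW r2)// ltr_pdivrMr// ltr_pMr// ltr1n.
Qed.

(** * Hadamard's inequality and the determinant bound *)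

(* Hadamard's inequality, by induction via the Schur complement. *)
Lemma posdef_det (F : realFieldType) (n : nat) (G : 'M[F]_n) :
  G^T = G -> (forall x : 'rV_n, x != 0 -> 0 < (x *m G *m x^T) 0 0) ->
  [/\ 0 < \det G, \det G <= \prod_i G i i &
    \prod_i G i i <= \det G -> is_diag_mx G].
Proof.
elim: n G => [|n IHn] G.
  by rewrite det_mx00 big_ord0 => _ _; split => // _; apply/is_diag_mxP => -[].
move: G; rewrite -[n.+1]/(1 + n)%N => G; rewrite -(submxK G).
move: (ulsubmx _) (ursubmx _) (dlsubmx _) (drsubmx _) => g v v' H {G}.
rewrite tr_block_mx => /eq_block_mx[_ v'E _ HT].
have {v'E} -> : v' = v^T by rewrite -v'E trmxK.
move=> Gpos.
have Hpos (x : 'rV_n) : x != 0 -> 0 < (x *m H *m x^T) 0 0.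
  move=> x0; have := Gpos (row_mx 0 x).
  rewrite mul_row_block !mul0mx !add0r tr_row_mx mul_row_col trmx0 mulmx0 add0r.
  by apply; rewrite row_mx_eq0 negb_and x0 orbT.
have [detH0 detHle detHeq] := IHn H HT Hpos.
have Hu : H \in unitmx by rewrite unitmxE unitfE gt_eqF.
(* [s] is the Schur complement of [H], and [w] is the row that eliminates [v]. *)
pose w := v *m invmx H; pose s := g - w *m v^T.
have wH : w *m H = v by rewrite mulmxKV.
have wv : w *m v^T = w *m H *m w^T by rewrite -{1}wH trmx_mul HT mulmxA.
have wv0 : 0 <= (w *m v^T) 0 0.
  rewrite wv; have [->|/Hpos/ltW//] := eqVneq w 0.
  by rewrite mul0mx mul0mx mxE.
have detG : \det (block_mx g v v^T H) = s 0 0 * \det H.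
  have -> : block_mx g v v^T H = block_mx 1%:M w 0 1%:M *m block_mx s 0 v^T H.
    by rewrite mulmx_block !mul1mx !mul0mx add0r subrK add0r wH add0r.
  rewrite det_mulmx det_ublock det_lblock !det1 !mul1r.
  by rewrite [s]mx11_scalar det_scalar1 -mx11_scalar.
have s0 : 0 < s 0 0.
  (* The quadratic form takes the value [s] at [(1, -w)]. *)
  have := Gpos (row_mx 1%:M (- w)).
  rewrite mul_row_block !mul1mx !mulNmx wH subrr tr_row_mx mul_row_col mul0mx addr0.
  rewrite trmx1 mulmx1; apply; rewrite row_mx_eq0 negb_and; apply/orP; left.
  by apply/eqP => /matrixP/(_ 0 0)/eqP; rewrite !mxE oner_eq0.
have sE : s 0 0 = g 0 0 - (w *m v^T) 0 0 by rewrite !mxE.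
have sg : s 0 0 <= g 0 0 by rewrite sE gerBl.
have prodG : \prod_i (block_mx g v v^T H) i i = g 0 0 * \prod_i H i i.
  rewrite (@big_split_ord _ _ _ 1 n) big_ord1 block_mxEul.
  by congr (_ * _); apply: eq_bigr => i _; rewrite block_mxEdr.
rewrite detG prodG; split.
- exact: mulr_gt0.
- by rewrite ler_pM// ltW.
- move=> le; have g0 : 0 < g 0 0 := lt_le_trans s0 sg.
  have gs : g 0 0 <= s 0 0.
    by rewrite -(ler_pM2r detH0) (le_trans _ le)// ler_pM2l.
  have w0 : w = 0.
    apply/eqP/negPn/negP => /Hpos; rewrite -wv; lra.
  have v0 : v = 0 by rewrite -wH w0 mul0mx.
  rewrite v0 trmx0 is_diag_block_mx// !eqxx/= mx11_is_diag detHeq//.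
  by rewrite -(ler_pM2l g0) (le_trans le)// ler_pM2r.
Qed.

Lemma row_sqnormE (R : nzSemiRingType) (n : nat) (y : 'rV[R]_n) :
  (y *m y^T) 0 0 = \sum_k y 0 k ^+ 2.
Proof. by rewrite mxE; apply: eq_bigr => k _; rewrite mxE expr2. Qed.

Lemma prod_ge_eq (R : realDomainType) (m : nat) (F : 'I_m -> R) (r : R) :
  (forall i, 0 <= F i <= r) -> 0 < r -> r ^+ m <= \prod_i F i -> forall i, F i = r.
Proof.
move=> F0r r0 rF k; apply/eqP/negPn/negP => Fk; move: rF; apply/negP.
rewrite -ltNge (bigD1 k)//=.
have /andP[Fk0 Fkr] := F0r k.
have -> : r ^+ m = r * \prod_(i < m | i != k) r.
  by rewrite -[m in LHS]card_ord -prodr_const (bigD1 k).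
have Fkr' : F k < r by rewrite lt_neqAle Fk.
apply: (@le_lt_trans _ _ (F k * \prod_(i < m | i != k) r)).
  by rewrite ler_wpM2l// ler_prod.
by rewrite ltr_pM2r// prodr_gt0.
Qed.

Section JohnBound.
Variables (R : realType) (n : nat).

(** For positive [n] this is [1/n - 1/(n+1)], the squared distance in barycentric coordinates from
    the centroid to the boundary of the John ellipsoid. *)
Definition john_scale : R := (n%:R * n.+1%:R)^-1.

Hypothesis n_gt0 : (0 < n)%N.
Let n0 : (0 : R) < n%:R. Proof. by rewrite ltr0n. Qed.
Let n10 : (0 : R) < n.+1%:R. Proof. by rewrite ltr0n. Qed.
Local Notation s := john_scale.

Lemma john_scale_gt0 : 0 < s.
Proof. by rewrite invr_gt0 mulr_gt0. Qed.

(* The columns [(mu i / sqrt n, W _ i)] have squared norm at most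
   [(1 + 1/n) mu i ^ 2], so Hadamard's inequality and AM-GM bound the
   determinant; the weight [1 / sqrt n] is the one for which the columns of the
   regular configuration become orthogonal. *)
Lemma john_det_bound (mu : 'rV[R]_(1 + n)) (W : 'M[R]_(n, 1 + n)) :
  (col_mx mu W : 'M[R]_(1 + n)) \in unitmx ->
  \sum_i mu 0 i = 1 -> (forall i, 0 <= mu 0 i) ->
  (forall i, \sum_k W k i ^+ 2 <= mu 0 i ^+ 2) ->
  (\det (col_mx mu W : 'M[R]_(1 + n))) ^+ 2 <= n%:R * s ^+ n.+1 /\
  (n%:R * s ^+ n.+1 <= (\det (col_mx mu W : 'M[R]_(1 + n))) ^+ 2 ->
   mu = const_mx n.+1%:R^-1 /\ W *m W^T = s%:M).
Proof.
move=> MWu mu1 mu0 Wmu.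
pose al : R := Num.sqrt n%:R^-1.
have al2 : al ^+ 2 = n%:R^-1 by rewrite sqr_sqrtr// invr_ge0 ltW.
have al0 : al != 0 by rewrite sqrtr_eq0 -ltNge invr_gt0.
pose Z : 'M[R]_(1 + n) := col_mx (al *: mu) W.
have ZE : Z = block_mx al%:M 0 0 1%:M *m (col_mx mu W : 'M[R]_(1 + n)).
  by rewrite mul_block_col !mul0mx mul1mx addr0 add0r mul_scalar_mx.
have detZ : \det Z = al * \det (col_mx mu W : 'M[R]_(1 + n)).
  by rewrite ZE det_mulmx det_ublock det_scalar1 det1 mulr1.
have Zu : Z \in unitmx.
  by rewrite unitmxE detZ unitrM -unitmxE MWu andbT unitfE.
(* Gram matrix of the columns of [Z]; its diagonal holds their squared norms. *)
pose G := Z^T *m Z.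
have GT : G^T = G by rewrite trmx_mul trmxK.
have Gpos (x : 'rV_(1 + n)) : x != 0 -> 0 < (x *m G *m x^T) 0 0.
  move=> x0; set y := x *m Z^T.
  have -> : x *m G *m x^T = y *m y^T by rewrite /y /G trmx_mul trmxK !mulmxA.
  have y0 : y != 0.
    apply: contraNneq x0 => y0.
    by rewrite -[x](mulmxK (_ : Z^T \in unitmx)) ?unitmx_tr// -/y y0 mul0mx.
  have /rV0Pn[k yk] := y0.
  rewrite row_sqnormE (bigD1 k)//= ltr_wpDr ?exprn_even_gt0//.
  by apply: sumr_ge0 => i _; rewrite sqr_ge0.
have [detG0 detGle detGeq] := posdef_det GT Gpos.
have detG : \det G = n%:R^-1 * (\det (col_mx mu W : 'M[R]_(1 + n))) ^+ 2.
  by rewrite det_mulmx det_tr detZ -expr2 exprMn al2.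
have Gii i : G i i = n%:R^-1 * mu 0 i ^+ 2 + \sum_k W k i ^+ 2.
  rewrite mxE (@big_split_ord _ _ _ 1 n) big_ord1 !mxE; congr (_ + _).
    by rewrite (unsplitK (inl _)) !mxE -expr2 exprMn al2.
  by apply: eq_bigr => k _; rewrite !mxE (unsplitK (inr _)) -expr2.
have Gle i : 0 <= G i i <= n.+1%:R / n%:R * mu 0 i ^+ 2.
  rewrite Gii addr_ge0 ?sumr_ge0 ?mulr_ge0 ?invr_ge0 ?(ltW n0) ?sqr_ge0//=; last first.
    by move=> k _; rewrite sqr_ge0.
  rewrite -natr1 mulrDl divff ?gt_eqF// mul1r mulrDl mul1r addrC lerD2r.
  exact: Wmu.
have prodG : \prod_i G i i <= (n.+1%:R / n%:R) ^+ n.+1 * (\prod_i mu 0 i) ^+ 2.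
  have -> : (n.+1%:R / n%:R) ^+ n.+1 = \prod_(i < 1 + n) (n.+1%:R / n%:R : R).
    by rewrite prodr_const card_ord.
  rewrite -prodrXl -big_split /=.
  by apply: ler_prod => i _; exact: Gle.
have [AGM AGMeq] := @leif_AGM R 'I_(1 + n) xpredT (fun i => mu 0 i) (fun i _ => mu0 i).
rewrite mu1 card_ord div1r in AGM AGMeq.
have prodmu0 : 0 <= \prod_i mu 0 i by apply: prodr_ge0.
have sE : s ^+ n.+1 = (n.+1%:R / n%:R) ^+ n.+1 * (n.+1%:R^-1 ^+ n.+1) ^+ 2.
  rewrite -exprM mulnC exprM -exprMn; congr (_ ^+ _).
  by rewrite /s; field; rewrite !gt_eqF.
have c0 : 0 < (n.+1%:R / n%:R : R) ^+ n.+1 by rewrite exprn_gt0// divr_gt0.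
have prodmu : (n.+1%:R / n%:R) ^+ n.+1 * (\prod_i mu 0 i) ^+ 2 <= s ^+ n.+1.
  by rewrite sE ler_pM2l// ler_pXn2r// nnegrE ?exprn_ge0 ?invr_ge0 ?ltW.
have s0 := john_scale_gt0.
split.
  rewrite -ler_pdivrMl// -detG.
  exact: le_trans detGle (le_trans prodG prodmu).
rewrite -ler_pdivlMl// -detG => sdet.
have sprod := le_trans sdet detGle.
(* Equality throughout forces equality in AM-GM, so all [mu 0 i] coincide, and they sum to 1. *)
have muE i : mu 0 i = n.+1%:R^-1.
  have : \prod_i mu 0 i == n.+1%:R^-1 ^+ n.+1.
    rewrite eq_le AGM /=.
    have := le_trans sprod prodG.
    by rewrite sE ler_pM2l// ler_pXn2r// nnegrE ?exprn_ge0 ?invr_ge0 ?ltW.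
  rewrite AGMeq => /forallP/(_ i)/implyP/(_ isT)/forallP mui.
  have : \sum_j mu 0 j = \sum_(j < 1 + n) mu 0 i.
    by apply: eq_bigr => j _; have := mui j => /implyP/(_ isT)/eqP.
  rewrite mu1 sumr_const card_ord => one.
  by apply: (mulIf (lt0r_neq0 n10)); rewrite mulVf ?gt_eqF// mulr_natr -one.
split; first by apply/rowP => i; rewrite muE mxE.
have Gs i : G i i = s.
  apply: (@prod_ge_eq R (1 + n) (fun i => G i i)) => // j.
  have := Gle j; rewrite muE.
  have -> // : n.+1%:R / n%:R * n.+1%:R^-1 ^+ 2 = s.
  by rewrite /s; field; rewrite !gt_eqF.
have GE : G = s%:M.
  have /is_diag_mxP Gd := detGeq (le_trans (le_trans prodG prodmu) sdet).
  apply/matrixP => i j; rewrite [RHS]mxE; case: eqVneq => [->|ij].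
    by rewrite Gs mulr1n.
  by rewrite mulr0n Gd.
(* [Z] is square, so [Z^T Z = s I] can be commuted; the lower right block of [Z Z^T] is [W W^T]. *)
have ZZT : Z *m Z^T = s%:M.
  have : (s^-1 *: Z^T) *m Z = 1%:M.
    by rewrite -scalemxAl -/G GE scale_scalar_mx mulVf ?gt_eqF.
  move=> /mulmx1C; rewrite -scalemxAr => /(congr1 (fun X => s *: X)).
  by rewrite scalerA divff ?gt_eqF// scale1r scale_scalar_mx mulr1.
have := congr1 drsubmx ZZT.
rewrite tr_col_mx mul_col_row block_mxKdr => ->.
by rewrite (@scalar_mx_block _ 1 n) block_mxKdr.
Qed.

End JohnBound.

(** * Barycentric coordinates *)

Section BarycentricCoordinates.
Variables (R : realType) (n : nat) (P : 'I_n.+1 -> 'rV[R]_n).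

(* Row [i] is [(1, P i)], so that barycentric coordinates are obtained from
   [(1, x)] by multiplication with the inverse. *)
Definition homogeneous_mx : 'M[R]_(1 + n) :=
  row_mx (const_mx 1 : 'cV[R]_(1 + n)) (\matrix_(i < 1 + n) P i).

Definition bary (x : 'rV[R]_n) : 'rV[R]_(1 + n) :=
  row_mx (1%:M : 'M[R]_1) x *m invmx homogeneous_mx.

Hypothesis P_indep : affinely_independent P.

(** A row [v] in the left kernel has coordinate sum 0 and [\sum_i v 0 i *: P i = 0]; subtracting
    [P ord0] leaves a relation between the independent rows [P (lift ord0 i) - P ord0]. *)
Lemma homogeneous_mx_unit : homogeneous_mx \in unitmx.
Proof.
rewrite -row_free_unit -kermx_eq0; apply/rowV0P => v /sub_kermxP.
rewrite mul_mx_row -[RHS]row_mx0 => /eq_row_mx[v1 vP].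
have vsum : \sum_i v 0 i = 0.
  have /matrixP/(_ 0 0) := v1; rewrite !mxE => {2}<-.
  by apply: eq_bigr => i _; rewrite mxE mulr1.
have vP0 : \sum_i v 0 i *: (P i - P ord0) = 0.
  under eq_bigr do rewrite scalerBr.
  rewrite sumrB -scaler_suml vsum scale0r subr0 -[RHS]vP.
  by rewrite mulmx_sum_row; apply: eq_bigr => i _; rewrite rowK.
have vl : \row_(i < n) v 0 (lift ord0 i) = 0.
  apply: (row_free_inj P_indep); rewrite mul0mx mulmx_sum_row -[RHS]vP0.
  rewrite [RHS]big_ord_recl subrr scaler0 add0r.
  by apply: eq_bigr => i _; rewrite rowK mxE.
have vl0 i : v 0 (lift ord0 i) = 0 by have /rowP/(_ i) := vl; rewrite !mxE.
apply/rowP => i; rewrite mxE; have [j ->|->] := unliftP ord0 i; first exact: vl0.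
by rewrite -[RHS]vsum [RHS]big_ord_recl big1 ?addr0.
Qed.

Let Hu := homogeneous_mx_unit.

Lemma barycentricE (x : 'rV[R]_n) (lam : 'I_n.+1 -> R) :
  barycentric P x lam <-> bary x = \row_i lam i.
Proof.
have lamH : (\row_i lam i : 'rV[R]_(1 + n)) *m homogeneous_mx =
    row_mx (\sum_i lam i)%:M (\sum_i lam i *: P i).
  rewrite mul_mx_row; congr row_mx.
    apply/matrixP => i j; rewrite !ord1 !mxE eqxx mulr1n.
    by apply: eq_bigr => k _; rewrite !mxE mulr1.
  by rewrite mulmx_sum_row; apply: eq_bigr => i _; rewrite rowK mxE.
split=> [[lam1 xE]|xE].
  by rewrite /bary xE -lam1 -lamH mulmxK.
have := mulmxKV Hu (row_mx (1%:M : 'M[R]_1) x); rewrite -/(bary x) xE lamH.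
move=> /eq_row_mx[lam1 <-]; split=> //.
by have /matrixP/(_ 0 0) := lam1; rewrite !mxE !eqxx.
Qed.

Lemma sum_bary (x : 'rV[R]_n) : \sum_i bary x 0 i = 1.
Proof.
have [] // := (barycentricE x (fun i => bary x 0 i)).2 _.
by apply/rowP => i; rewrite [RHS]mxE.
Qed.

Lemma simplexE (x : 'rV[R]_n) : simplex P x <-> forall i, 0 <= bary x 0 i.
Proof.
split=> [[lam lam0 /barycentricE ->] i|x0]; first by rewrite mxE.
exists (fun i => bary x 0 i) => //; apply/barycentricE.
by apply/rowP => i; rewrite [RHS]mxE.
Qed.

(** The rows [(1, c)] and [(0, B_k)] are a point and directions in homogeneous form; [mu] and the
    rows of [W] are their barycentric coordinates. *)
Lemma bary_affine (c u : 'rV[R]_n) (B : 'M[R]_n) (mu : 'rV[R]_(1 + n))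
    (W : 'M[R]_(n, 1 + n)) :
  block_mx 1%:M c 0 B = (col_mx mu W : 'M[R]_(1 + n)) *m homogeneous_mx ->
  bary (c + u *m B) = mu + u *m W.
Proof.
move=> cB; rewrite /bary.
have -> : row_mx (1%:M : 'M[R]_1) (c + u *m B) = row_mx 1%:M u *m block_mx 1%:M c 0 B.
  by rewrite mul_row_block !mul1mx mulmx0 addr0.
by rewrite cB mulmxA mulmxK// mul_row_col mul1mx.
Qed.

Lemma bary_line (c x : 'rV[R]_n) (t : R) :
  bary (x + t *: (x - c)) = (1 + t) *: bary x - t *: bary c.
Proof.
rewrite /bary !scalemxAl -mulmxBl; congr (_ *m _).
rewrite !scale_row_mx opp_row_mx add_row_mx -scalerBl addrK scale1r.
by congr row_mx; apply/rowP => i; rewrite !mxE; ring.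
Qed.

Lemma bary_continuous i : continuous (fun x => bary x 0 i).
Proof.
have -> : (fun x => bary x 0 i) = fun x : 'rV[R]_n =>
    invmx homogeneous_mx (lshift n 0) i +
    \sum_j x 0 j * invmx homogeneous_mx (rshift 1 j) i.
  apply/funext => x; rewrite mxE (@big_split_ord _ _ _ 1 n) big_ord1 /=.
  rewrite row_mxEl mxE eqxx mul1r; congr (_ + _).
  by apply: eq_bigr => j _; rewrite row_mxEr.
have coordM_cont j (k : R) : continuous (fun x : 'rV[R]_n => x 0 j * k).
  by move=> x; exact: (cvgM (@coord_continuous R 1 n 0 j x) (cvg_cst _)).
have sum_cont : continuous (fun x : 'rV[R]_n =>
    \sum_j x 0 j * invmx homogeneous_mx (rshift 1 j) i).
  apply: continuous_big => [|j _]; first exact: add_continuous.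
  exact: coordM_cont.
by move=> x; exact: (cvgD (cvg_cst _) (sum_cont x)).
Qed.

End BarycentricCoordinates.

(** * The John ellipsoid of a simplex *)

Section JohnEllipsoidOfSimplex.
Variables (R : realType) (n : nat) (P : 'I_n.+1 -> 'rV[R]_n).
Hypothesis n_gt0 : (0 < n)%N.
Hypothesis P_indep : affinely_independent P.

Local Notation s := (john_scale R n).
Local Notation H := (homogeneous_mx P).
Let Hu : H \in unitmx := homogeneous_mx_unit P_indep.
Let n0 : (0 : R) < n%:R. Proof. by rewrite ltr0n. Qed.
Let n10 : (0 : R) < n.+1%:R. Proof. by rewrite ltr0n. Qed.
Let s0 : 0 < s := john_scale_gt0 R n_gt0.

Definition bary_sqnorm (x : 'rV[R]_n) : R := \sum_i bary P x 0 i ^+ 2.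

Definition bary_ball : set 'rV[R]_n := [set x | bary_sqnorm x <= n%:R^-1].

Lemma centered_sqnorm (z : 'rV[R]_(1 + n)) : \sum_i z 0 i = 0 ->
  \sum_i (n.+1%:R^-1 + z 0 i) ^+ 2 = n.+1%:R^-1 + \sum_i z 0 i ^+ 2.
Proof.
move=> z0; under eq_bigr do rewrite sqrrD.
have mz : \sum_i n.+1%:R^-1 * z 0 i = 0 by rewrite -mulr_sumr z0 mulr0.
rewrite !big_split /= mz !addr0; congr (_ + _).
by rewrite sumr_const card_ord -mulr_natr; field; rewrite gt_eqF.
Qed.

(** By [centered_sqnorm] the image of [u] has squared barycentric norm [1/(n+1) + s |u|^2], which is
    at most [1/n] exactly when [|u| <= 1]. *)
Lemma ellipsoid_bary_ball (c : 'rV[R]_n) (B : 'M[R]_n) (W : 'M[R]_(n, 1 + n)) :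
  B \in unitmx ->
  block_mx 1%:M c 0 B = (col_mx (const_mx n.+1%:R^-1) W : 'M[R]_(1 + n)) *m H ->
  W *m W^T = s%:M ->
  affine_image c B (@euclidean_ball R n) = bary_ball.
Proof.
move=> Bu cB WW.
have sqE u : bary_sqnorm (c + u *m B) = n.+1%:R^-1 + s * \sum_k u 0 k ^+ 2.
  rewrite /bary_sqnorm (bary_affine P_indep u cB).
  have uW0 : \sum_i (u *m W) 0 i = 0.
    have := sum_bary P_indep (c + u *m B); rewrite (bary_affine P_indep u cB).
    under eq_bigr do rewrite mxE [const_mx _ _ _]mxE.
    rewrite big_split /= sumr_const card_ord -[_ *+ _]mulr_natr mulVf ?gt_eqF//.
    by move=> uW1; apply: (addrI 1); rewrite uW1 addr0.
  under eq_bigr do rewrite mxE [const_mx _ _ _]mxE.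
  rewrite centered_sqnorm// -row_sqnormE trmx_mul mulmxA -(mulmxA u) WW.
  by rewrite mul_mx_scalar -scalemxAl mxE row_sqnormE.
have ballE u : bary_ball (c + u *m B) <-> euclidean_ball u.
  rewrite /bary_ball /euclidean_ball /= sqE -lerBrDl.
  have -> : n%:R^-1 - n.+1%:R^-1 = s * 1.
    by rewrite /john_scale -natr1; field; rewrite natr1 !gt_eqF.
  by rewrite ler_pM2l.
apply/seteqP; split=> [_ [u /ballE ? <-]//|x xb].
have xE : c + (x - c) *m invmx B *m B = x by rewrite mulmxKV// addrC subrK.
by exists ((x - c) *m invmx B) => //; apply/ballE; rewrite xE.
Qed.

(** Summing [(b_j - 1/n)^2 >= 0] over [j != i] bounds the other squares below by [1/n - 2 b_i / n],
    so membership in the ball forces [b_i^2 <= 2 b_i / n]. *)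
Lemma bary_ball_sub_simplex : bary_ball `<=` simplex P.
Proof.
move=> x xb; apply/(simplexE P_indep) => i; move: xb; rewrite /bary_ball /=.
set b := bary P x; rewrite /bary_sqnorm -/b (bigD1 i)//= => xb.
have b1 : \sum_j b 0 j = 1 := sum_bary P_indep x.
(* The value of the other coordinates where the ball touches the facet [b_i = 0]. *)
pose t : R := n%:R^-1.
have t0 : 0 < t by rewrite invr_gt0.
have tE : \sum_j (2 * t * b 0 j - t ^+ 2) = t - t ^+ 2.
  rewrite sumrB -mulr_sumr b1 sumr_const card_ord -[_ *+ _]mulr_natr.
  by rewrite -natr1 /t; field; rewrite gt_eqF.
have : \sum_(j | j != i) (2 * t * b 0 j - t ^+ 2) <= \sum_(j | j != i) b 0 j ^+ 2.
  apply: ler_sum => j _; rewrite -subr_ge0.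
  have -> : b 0 j ^+ 2 - (2 * t * b 0 j - t ^+ 2) = (b 0 j - t) ^+ 2 by ring.
  exact: sqr_ge0.
have := tE; rewrite (bigD1 i)//= => tE' le.
have bi2 := sqr_ge0 (b 0 i).
have : 0 <= t * b 0 i by rewrite -/t in xb; nra.
by rewrite pmulr_rge0.
Qed.

(** Over the unit ball the linear form of a nonzero [w] has its minimum [- |w|] at [- w / |w|]. *)
Lemma ball_support (m : R) (w : 'cV[R]_n) :
  (forall u, euclidean_ball u -> 0 <= m + (u *m w) 0 0) ->
  0 <= m /\ \sum_k w k 0 ^+ 2 <= m ^+ 2.
Proof.
move=> uw.
have m0 : 0 <= m.
  have := uw 0; rewrite mul0mx mxE addr0; apply.
  by rewrite /euclidean_ball /= big1 ?ler01// => k _; rewrite mxE expr0n.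
split=> //; set q := \sum_k _.
have q0 : 0 <= q by apply: sumr_ge0 => k _; rewrite sqr_ge0.
have [->|qn0] := eqVneq q 0; first exact: sqr_ge0.
have qs : Num.sqrt q ^+ 2 = q by rewrite sqr_sqrtr.
have qs0 : Num.sqrt q != 0 by rewrite sqrtr_eq0 -ltNge lt_neqAle eq_sym qn0.
have := uw (- (Num.sqrt q)^-1 *: w^T).
have -> : ((- (Num.sqrt q)^-1 *: w^T) *m w) 0 0 = - Num.sqrt q.
  rewrite -scalemxAl mxE -{2}[w]trmxK row_sqnormE.
  under eq_bigr do rewrite mxE.
  by rewrite -/q -{2}qs; field.
rewrite subr_ge0 => le; rewrite -qs ler_sqr ?nnegrE ?sqrtr_ge0//; apply: le.
rewrite /euclidean_ball /=; under eq_bigr do rewrite !mxE exprMn.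
by rewrite -mulr_sumr sqrrN -/q exprVn qs mulVf.
Qed.

(** Containment makes each barycentric coordinate [mu 0 i + (u *m W) 0 i] nonnegative on the ball;
    [ball_support] turns this into the column bounds of [john_det_bound]. The factor [\det H]
    converts barycentric to Cartesian coordinates. *)
Lemma ellipsoid_in_simplex (c : 'rV[R]_n) (B : 'M[R]_n) :
  B \in unitmx -> affine_image c B (@euclidean_ball R n) `<=` simplex P ->
  (\det B) ^+ 2 <= n%:R * s ^+ n.+1 * (\det H) ^+ 2 /\
  (n%:R * s ^+ n.+1 * (\det H) ^+ 2 <= (\det B) ^+ 2 ->
    affine_image c B (@euclidean_ball R n) = bary_ball).
Proof.
move=> Bu EB.
pose K : 'M[R]_(1 + n) := block_mx 1%:M c 0 B *m invmx H.
pose mu := usubmx K; pose W := dsubmx K.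
have KE : col_mx mu W = K := vsubmxK K.
have cB : block_mx 1%:M c 0 B = (col_mx mu W : 'M[R]_(1 + n)) *m H.
  by rewrite KE mulmxKV.
have detB : \det B = \det (col_mx mu W : 'M[R]_(1 + n)) * \det H.
  by rewrite -det_mulmx -cB det_ublock det1 mul1r.
have Ku : (col_mx mu W : 'M[R]_(1 + n)) \in unitmx.
  rewrite unitmxE; move: Bu; rewrite unitmxE detB unitrM => /andP[] //.
have H2 : 0 < \det H ^+ 2 by rewrite exprn_even_gt0//= -unitfE -unitmxE.
have muE : mu = bary P c.
  by have := bary_affine P_indep 0 cB; rewrite !mul0mx !addr0.
have supp i : 0 <= mu 0 i /\ \sum_k (col i W) k 0 ^+ 2 <= mu 0 i ^+ 2.
  apply: ball_support => u ub.
  have /EB/(simplexE P_indep)/(_ i) : affine_image c B (@euclidean_ball R n) (c + u *m B).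
    by exists u.
  rewrite (bary_affine P_indep u cB) mxE [(u *m W) _ _]mxE [(u *m col i W) _ _]mxE.
  by under [X in _ -> 0 <= _ + X]eq_bigr do rewrite mxE.
have [] := john_det_bound n_gt0 Ku _ _ _.
- by rewrite muE sum_bary.
- by move=> i; have [] := supp i.
- by move=> i; have [_] := supp i; under eq_bigr do rewrite mxE.
rewrite detB exprMn => le1 eq1; split; first by rewrite ler_pM2r.
rewrite ler_pM2r// => /eq1[muc WW].
by apply: (@ellipsoid_bary_ball c B W) => //; rewrite -muc.
Qed.

End JohnEllipsoidOfSimplex.

(* The rows of a Householder reflection sending the first basis vector to the
   normalized all-ones vector. *)
Lemma regular_configuration (R : realType) (n : nat) (s := john_scale R n) :
  (0 < n)%N -> exists W : 'M[R]_(n, 1 + n),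
  [/\ W *m W^T = s%:M, W *m (const_mx 1 : 'cV[R]_(1 + n)) = 0 &
    (\det (col_mx (const_mx n.+1%:R^-1) W : 'M[R]_(1 + n))) ^+ 2 = n%:R * s ^+ n.+1].
Proof.
move=> n_gt0; have s0 : 0 < s := john_scale_gt0 R n_gt0.
have n0 : (0 : R) < n%:R by rewrite ltr0n.
have n10 : (0 : R) < n.+1%:R by rewrite ltr0n.
pose r : R := Num.sqrt n.+1%:R^-1.
have r2 : r ^+ 2 = n.+1%:R^-1 by rewrite sqr_sqrtr// invr_ge0 ltW.
have r0 : 0 < r by rewrite sqrtr_gt0 invr_gt0.
have r1 : r < 1.
  rewrite -(expr_lt1 (n := 2))// ?(ltW r0)// r2 invf_lt1// ltr1n //.
have r1' : 1 - r != 0 by rewrite subr_eq0 gt_eqF.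
(* Its squared norm is [2 (1 - r)], so [Q] below is the reflection [I - 2 v^T v / |v|^2]. *)
pose v : 'rV[R]_(1 + n) := delta_mx 0 0 - const_mx r.
have vE j : v 0 j = (j == 0)%:R - r by rewrite !mxE eqxx.
have vv : v *m v^T = (2 * (1 - r))%:M.
  rewrite [LHS]mx11_scalar row_sqnormE; congr _%:M.
  have -> : \sum_k v 0 k ^+ 2 = \sum_(k < 1 + n) (r ^+ 2 + (k == 0)%:R * (1 - 2 * r)).
    apply: eq_bigr => k _; rewrite vE; case: (k == 0) => /=; ring.
  rewrite big_split /= sumr_const card_ord r2 -[_ *+ _]mulr_natr mulVf ?gt_eqF//.
  rewrite (bigD1 0)//= big1 ?addr0 => [|k /negbTE ->]; last by rewrite mul0r.
  ring.
pose k := (1 - r)^-1.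
pose Q : 'M[R]_(1 + n) := 1%:M - k *: (v^T *m v).
have QT : Q^T = Q.
  by rewrite /Q linearB /= linearZ /= trmx_mul trmxK tr_scalar_mx.
have QQ : Q *m Q^T = 1%:M.
  rewrite QT {1}/Q mulmxBl mul1mx -scalemxAl -[v^T *m v *m Q]mulmxA.
  have -> : v *m Q = - v.
    rewrite /Q mulmxBr mulmx1 -scalemxAr mulmxA vv mul_scalar_mx scalerA.
    by rewrite /k mulrCA mulVf// mulr1 scaler_nat mulr2n opprD addNKr.
  by rewrite mulmxN scalerN opprK /Q subrK.
have Q0 : usubmx Q = const_mx r.
  apply/rowP => j; rewrite 3!mxE [lshift n 0](_ : _ = 0); last exact/val_inj.
  rewrite 3!mxE big_ord1 !mxE eqxx /= /k.
  by rewrite eq_sym; field.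
pose W := dsubmx Q.
have QE : Q = col_mx (const_mx r) W by rewrite -Q0 vsubmxK.
have := QQ; rewrite QE tr_col_mx mul_col_row (@scalar_mx_block _ 1 n).
move=> /eq_block_mx[_ _ Wr WW].
have W1 : W *m (const_mx 1 : 'cV[R]_(1 + n)) = 0.
  have : r *: (W *m (const_mx 1 : 'cV[R]_(1 + n))) = 0.
    rewrite scalemxAr -[RHS]Wr; congr (_ *m _).
    by apply/colP => i; rewrite !mxE mulr1.
  by move=> /eqP; rewrite scalemx_eq0 gt_eqF//= => /eqP.
pose q := Num.sqrt s.
have q2 : q ^+ 2 = s by rewrite sqr_sqrtr// ltW.
exists (q *: W); split.
- by rewrite linearZ /= -scalemxAl -scalemxAr WW scalerA -expr2 q2 scale_scalar_mx mulr1.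
- by rewrite -scalemxAl W1 scaler0.
(* The first row of [Q] has entries [r], and [r^2 = 1/(n+1)]; the squared determinant is therefore
   [r^2 s^n = n s^(n+1)]. *)
- have -> : col_mx (const_mx n.+1%:R^-1) (q *: W) =
      block_mx r%:M 0 0 q%:M *m (col_mx (const_mx r) W : 'M[R]_(1 + n)).
    rewrite mul_block_col !mul0mx addr0 add0r !mul_scalar_mx; congr col_mx.
    by apply/rowP => i; rewrite !mxE -expr2 r2.
  rewrite -QE det_mulmx det_ublock !det_scalar expr1 !exprMn.
  have -> : \det Q ^+ 2 = 1.
    by have := congr1 determinant QQ; rewrite det_mulmx det_tr det1 expr2.
  rewrite mulr1 r2 -exprM mulnC exprM q2 exprS mulrA; congr (_ * _).
  by rewrite /s /john_scale; field; rewrite !gt_eqF.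
Qed.

(** * Maximality and uniqueness of the ellipsoid *)

Lemma vol_pos_fin (R : realType) (n : nat) (A : set 'rV[R]_n.+1) (x a b : 'rV[R]_n.+1) :
  interior A x -> A `<=` box a b -> exists2 v, 0 < v & vol A = v%:E.
Proof.
move=> Ax Aab.
have ab j : a 0 j <= b 0 j.
  by have /andP[] := Aab _ (interior_subset Ax) j; exact: le_trans.
have A0 := vol_interior_gt0 Ax.
have Afin := le_trans (le_vol Aab) (vol_box_le ab).
case E : (vol A) A0 Afin => [v| |]//; rewrite ?lte_fin => v0 _.
by exists v.
Qed.

(** A finite nonzero value makes volumes of ellipsoids comparable through [\det B]. *)
Lemma vol_euclidean_ball (R : realType) (n : nat) :
  exists2 v, 0 < v & vol (@euclidean_ball R n.+1) = v%:E.
Proof.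
apply: (@vol_pos_fin R n _ 0 (const_mx (-1)) (const_mx 1)).
  have n0 : (0 : R) < n.+1%:R^-1 by rewrite invr_gt0 ltr0n.
  apply/nbhs_ballP; exists n.+1%:R^-1 => //= u [_ u0].
  rewrite /euclidean_ball /=.
  apply: (@le_trans _ _ (\sum_(j < n.+1) n.+1%:R^-1)); last first.
    by rewrite sumr_const card_ord -[_ *+ _]mulr_natr mulVf// pnatr_eq0.
  apply: ler_sum => j _; have := u0 0 j; rewrite /ball /= !mxE sub0r normrN => uj.
  rewrite -real_normK ?num_real// expr2.
  apply: (@le_trans _ _ `|u 0 j|); last exact: ltW.
  by rewrite ler_piMl// (le_trans (ltW uj))// invf_le1 ?ltr0n// ler1n.
move=> u; rewrite /euclidean_ball /= => ub j; rewrite !mxE -ler_norml.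
rewrite -(@expr_le1 _ 2)// real_normK ?num_real//.
by apply: le_trans ub; rewrite (bigD1 j)//= lerDl sumr_ge0// => i _; rewrite sqr_ge0.
Qed.

(** The regular configuration, transported to the vertices [P i], attains the bound of
    [ellipsoid_in_simplex]; the equality case there identifies every maximizer with the same set. *)
Lemma john_ellipsoid_simplex (R : realType) (n : nat) (P : 'I_n.+2 -> 'rV[R]_n.+1) :
  affinely_independent P -> john_ellipsoid (simplex P) = bary_ball P.
Proof.
move=> P_indep.
have Hu := homogeneous_mx_unit P_indep.
have H0 : \det (homogeneous_mx P) != 0 by rewrite -unitfE -unitmxE.
have [vB vB0 volB] := vol_euclidean_ball R n.
pose m : R := n.+2%:R^-1.
have [W [WW W1 detW]] := @regular_configuration R n.+1 isT.
pose PM : 'M[R]_(1 + n.+1, n.+1) := \matrix_i P i.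
(* [c] is the centroid, and the rows of [B] are the directions with barycentric coordinates [W]. *)
pose c := (const_mx m : 'rV[R]_(1 + n.+1)) *m PM; pose B := W *m PM.
have cB : block_mx 1%:M c 0 B =
    (col_mx (const_mx m) W : 'M[R]_(1 + n.+1)) *m homogeneous_mx P.
  rewrite mul_col_row W1; congr (block_mx _ _ _ _).
  apply/matrixP => i j; rewrite !ord1 !mxE eqxx.
  under eq_bigr do rewrite !mxE mulr1.
  by rewrite sumr_const card_ord mulr1n -[RHS]mulr_natr /m mulVf ?pnatr_eq0.
have detB : \det B ^+ 2 = n.+1%:R * john_scale R n.+1 ^+ n.+2 * \det (homogeneous_mx P) ^+ 2.
  by rewrite -detW -exprMn -det_mulmx -cB det_ublock det1 mul1r.
have Bu : B \in unitmx.
  rewrite unitmxE unitfE -sqrf_eq0 detB.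
  rewrite gt_eqF// mulr_gt0 ?exprn_even_gt0// mulr_gt0 ?ltr0n//.
  by rewrite exprn_gt0// john_scale_gt0.
have E0 := @ellipsoid_bary_ball R n.+1 P isT P_indep c B W Bu cB WW.
have volE c' B' : B' \in unitmx ->
    vol (affine_image c' B' (@euclidean_ball R n.+1)) = (`|\det B'| * vB)%:E.
  by move=> B'u; exact: vol_affine_image.
have max0 : max_volume_ellipsoid (simplex P) (bary_ball P).
  split; [by exists c, B | exact: bary_ball_sub_simplex |].
  move=> _ [c' [B' B'u ->]] E'S.
  rewrite -E0 [leLHS]volE// volE// lee_fin ler_pM2r//.
  have [] := @ellipsoid_in_simplex R n.+1 P isT P_indep c' B' B'u E'S.
  by rewrite -detB -ler_sqr ?nnegrE// !real_normK ?num_real.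
(* The maximizers form a singleton, so [xget] returns its element and not the default [set0]. *)
have max1 : [set E | max_volume_ellipsoid (simplex P) E] = [set bary_ball P].
  apply/seteqP; split => [_ [[c' [B' B'u ->]] E'S max']|_ -> //].
  have [_] := @ellipsoid_in_simplex R n.+1 P isT P_indep c' B' B'u E'S; apply.
  have [E0ell E0S _] := max0.
  have := max' _ E0ell E0S; rewrite -E0 [leLHS]volE// volE// lee_fin ler_pM2r//.
  by rewrite -ler_sqr ?nnegrE// !real_normK ?num_real// detB.
suff : [set bary_ball P] (john_ellipsoid (simplex P)) by [].
by rewrite -max1; apply: xgetPex; exists (bary_ball P).
Qed.

(** * Boundary and corner simplexes *)

Lemma bary_sqnorm_continuous (R : realType) (n : nat) (P : 'I_n.+1 -> 'rV[R]_n) :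
  continuous (bary_sqnorm P).
Proof.
have sq_cont i : continuous (fun x => bary P x 0 i ^+ 2).
  by move=> x; exact: (cvgM (@bary_continuous R n P i x) (@bary_continuous R n P i x)).
rewrite /bary_sqnorm; apply: continuous_big => [|i _]; first exact: add_continuous.
exact: sq_cont.
Qed.

(** By continuity the sublevel set is closed and the strict one open. Conversely, moving a point of
    the level set away from the centroid increases the squared norm, so the point is not
    interior. *)
Lemma boundary_bary_ball (R : realType) (n : nat) (P : 'I_n.+1 -> 'rV[R]_n)
    (M : 'rV[R]_n) :
  (0 < n)%N -> affinely_independent P ->
  boundary (bary_ball P) M <-> bary_sqnorm P M = n%:R^-1.
Proof.
move=> n_gt0 P_indep; have q_cont := @bary_sqnorm_continuous R n P.
split=> [[clM nintM]|qM].
  have : bary_sqnorm P M <= n%:R^-1.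
    have clE : closed (bary_ball P).
      by apply: (@preimage_closed _ _ (bary_sqnorm P) [set t | t <= n%:R^-1]) => [x _|];
        [exact: q_cont | exact: closed_le].
    by move: clM; rewrite -(closure_id _).1.
  rewrite le_eqVlt => /orP[/eqP//|qlt]; case: nintM.
  have opE : open (bary_sqnorm P @^-1` [set t | t < n%:R^-1]).
    by apply: open_comp => [x _|]; [exact: q_cont | exact: open_lt].
  apply: (@filterS _ _ _ (bary_sqnorm P @^-1` [set t | t < n%:R^-1])).
    by move=> x /ltW.
  exact: open_nbhs_nbhs.
split; first by apply: subset_closure; rewrite /bary_ball /= qM.
move=> /nbhs_ballP[r /= r0 rE].
pose m : R := n.+1%:R^-1.
have n0 : (0 : R) < n%:R by rewrite ltr0n.
have n10 : (0 : R) < n.+1%:R by rewrite ltr0n.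
pose c : 'rV[R]_n := \sum_i m *: P i.
have cE : bary P c = const_mx m.
  rewrite (barycentricE P_indep c (fun=> m)).1; first by apply/rowP => i; rewrite !mxE.
  by split=> //; rewrite sumr_const card_ord -[LHS]mulr_natr mulVf ?gt_eqF.
have linE (u v : 'rV[R]_(1 + n)) (a b : R) i :
    (a *: u - b *: v) 0 i = a * u 0 i - b * v 0 i by rewrite !mxE.
(* Small enough to stay within distance [r] of [M]; the added 1 keeps the denominator positive. *)
pose t := r / (2 * (1 + `|M - c|)).
have den0 : 0 < 2 * (1 + `|M - c|) by rewrite mulr_gt0// ltr_wpDr.
have t0 : 0 < t by rewrite divr_gt0.
have : bary_ball P (M + t *: (M - c)).
  apply: rE; rewrite -ball_normE /= opprD addNKr normrN normrZ gtr0_norm//.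
  rewrite /t mulrAC ltr_pdivrMr// ltr_pM2l//.
  by have := normr_ge0 (M - c); lra.
rewrite /bary_ball /= leNgt => /negP; apply.
rewrite /bary_sqnorm bary_line// cE.
have -> : \sum_i (((1 + t) *: bary P M - t *: const_mx m) 0 i) ^+ 2 =
    \sum_i ((1 + t) ^+ 2 * bary P M 0 i ^+ 2 +
      (- (2 * t * (1 + t) * m) * bary P M 0 i + t ^+ 2 * m ^+ 2)).
  by apply: eq_bigr => i _; rewrite linE [const_mx _ _ _]mxE; ring.
rewrite !big_split /= -!mulr_sumr (sum_bary P_indep) -/(bary_sqnorm P M) qM.
rewrite sumr_const card_ord -[m *+ _]mulr_natr -[(1 + n)%N]/n.+1.
(* The squared norm grows by [(1/n - m) t (2 + t)], which is positive since [m = 1/(n+1)]. *)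
have -> : (1 + t) ^+ 2 * n%:R^-1 + (- (2 * t * (1 + t) * m) * 1 + t ^+ 2 * (m * (m * n.+1%:R)))
    = n%:R^-1 + (n%:R^-1 - m) * (t * (2 + t)).
  by rewrite /m -natr1; field; rewrite nat1r !gt_eqF.
rewrite ltrDl mulr_gt0//; last by rewrite mulr_gt0// addr_gt0.
by rewrite subr_gt0 /m ltf_pV2 ?posrE// ltr_nat.
Qed.

(** The homothety has matrix [l%:M], of determinant [l ^+ n.+1]. For ratio 0 this matrix is
    singular, and the upper bound of [dilates_diag] takes over. *)
Lemma vol_corner_simplex (R : realType) (n : nat) (P : 'I_n.+2 -> 'rV[R]_n.+1)
    (M : 'rV[R]_n.+1) (lam : 'I_n.+2 -> R) (i : 'I_n.+2) (V : R) :
  0 <= lam i -> vol (simplex P) = V%:E ->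
  vol (corner_simplex P M lam i) = (lam i ^+ n.+1 * V)%:E.
Proof.
set l := lam i => l0 volS.
have -> : corner_simplex P M lam i = affine_image (M - l *: P i) l%:M (simplex P).
  by apply/seteqP; split => _ [x Sx <-]; exists x => //;
    rewrite mul_mx_scalar scalerBr addrAC addrA.
have [l00|ln0] := eqVneq l 0.
  have := @dilates_diag R n 0 (M - l *: P i) (simplex P) V.
  rewrite volS lexx => /(_ isT).
  have -> : diag_mx (0 : 'rV[R]_n.+1) = l%:M.
    by apply/matrixP => a b; rewrite l00 !mxE.
  rewrite big_ord_recl mxE normr0 !mul0r => le0.
  have -> : l ^+ n.+1 * V = 0 by rewrite l00 exprS !mul0r.
  by apply/eqP; rewrite eq_le le0 vol_ge0.
have lu : l%:M \in @unitmx R n.+1.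
  by rewrite unitmxE det_scalar unitfE expf_neq0.
by rewrite (vol_affine_image _ lu volS) det_scalar ger0_norm ?exprn_ge0.
Qed.

Lemma vol_simplex (R : realType) (n : nat) (P : 'I_n.+2 -> 'rV[R]_n.+1) (M : 'rV[R]_n.+1) :
  interior (simplex P) M -> exists2 V, 0 < V & vol (simplex P) = V%:E.
Proof.
move=> hM; pose b : 'rV[R]_n.+1 := \row_j \sum_i `|P i 0 j|.
apply: (vol_pos_fin (a := - b) (b := b) hM) => x [lam lam0 [lam1 ->]] j.
have lam_le1 i : lam i <= 1.
  by rewrite -lam1 (bigD1 i)//= lerDl sumr_ge0.
rewrite [(- b) 0 j]mxE -ler_norml summxE mxE.
rewrite (le_trans (ler_norm_sum _ _ _))// ler_sum// => i _.
by rewrite mxE normrM ger0_norm// ler_piMl.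
Qed.

Theorem theorem1 (R : realType) (n : nat) (hn : (1 <= n)%N)
    (P : 'I_n.+1 -> 'rV[R]_n) (hP : affinely_independent P)
    (M : 'rV[R]_n) (hM : interior (simplex P) M)
    (lam : 'I_n.+1 -> R) (hlam : barycentric P M lam) :
  boundary (john_ellipsoid (simplex P)) M <->
  (\sum_(i < n.+1) vol (corner_simplex P M lam i) `^ (2 / n%:R)%R
     = (n%:R^-1)%:E * vol (simplex P) `^ (2 / n%:R)%R)%E.
Proof.
case: n hn P hP M hM lam hlam => // n _ P hP M hM lam hlam.
rewrite john_ellipsoid_simplex//.
have /(barycentricE hP) lamE := hlam.
have lam0 i : 0 <= lam i.
  by have /(simplexE hP)/(_ i) := interior_subset hM; rewrite lamE mxE.
have [V V0 volS] := vol_simplex hM.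
have lamn i : (lam i ^+ n.+1) `^ (2 / n.+1%:R) = lam i ^+ 2.
  by rewrite -powR_mulrn// -powRrM mulrCA divff ?pnatr_eq0// mulr1 powR_mulrn.
rewrite volS poweR_EFin.
under eq_bigr => i _.
  rewrite (vol_corner_simplex M (lam0 i) volS) poweR_EFin.
  rewrite powRM ?exprn_ge0 ?(ltW V0)// lamn; over.
rewrite sumEFin -mulr_suml -EFinM.
rewrite boundary_bary_ball//.
have -> : bary_sqnorm P M = \sum_i lam i ^+ 2.
  by rewrite /bary_sqnorm lamE; apply: eq_bigr => i _; rewrite mxE.
(* Positivity of [V] allows this common factor of both sides to be cancelled. *)
have W0 : V `^ (2 / n.+1%:R) != 0 by rewrite gt_eqF// powR_gt0.
by split=> [-> //|[] /(mulIf W0)].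
Qed.
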